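(* Let $C$ be a fully faithful framed bicategory. Then there exists a $\pi_2$-opindexing $\Phi$ on $H^*C$ such that $C$ induces $\Phi$. Likewise, if $C$ is an absolutely dense framed bicategory, then there exists a $\pi_2$-indexing $\Phi$ on $H^*C$ such that $C$ induces $\Phi$.
   Context: **Double categories.** A double category $C$ has a category of objects and vertical morphisms $C_0$, a category of horizontal morphisms and squares $C_1$ (composition in $C_1$ is vertical composition of squares), left and right frame functors $L,R:C_1\to C_0$, a unit functor $U:C_0\to C_1$, and horizontal composition. Vertical composition is strict; horizontal composition may be associative and unital only up to coherent globular isomorphism. For squares, $\psi\circ\varphi$ denotes the vertical composite with $\varphi$ on top and $\psi$ below. $U_a$ is the horizontal identity of an object $a$ and $U_f$ is the horizontal identity (unit) square of a vertical morphism $f$. A square is globular if its left and right frames are vertical identities. Objects, horizontal morphisms and globular squares of $C$ form a bicategory $HC$. $H^*C$ is the pair $(C_0,HC)$. $\pi_2(C,a)=\pi_2(HC,a)$ is the set of globular squares $U_a\Rightarrow U_a$; by Eckmann–Hilton it is a commutative monoid. **Framed bicategories.** A framed bicategory is a double category $C$ such that $L\times R:C_1\to C_0\times C_0$ is a bifibration; it is assumed throughout that $L\times R$ is a cloven and normal fibration (a choice of cartesian lifts is given, and the chosen lift along a pair of vertical identities is the identity square). A framed bicategory is fully faithful if $U_f$ is cartesian (for $L\times R$) for every vertical morphism $f$, and absolutely dense if $U_f$ is opcartesian for every vertical morphism $f$. **$\pi_2$-indexings and $\pi_2$-opindexings on $H^*C$.** A $\pi_2$-indexing on $H^*C$ is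 a functor $\Phi:C_0\to\mathbf{commMon}$ to the category of commutative monoids with $\Phi(a)=\pi_2(C,a)$ for every object $a$. A $\pi_2$-opindexing on $H^*C$ is a functor $\Phi:C_0^{op}\to\mathbf{commMon}$ with $\Phi(a)=\pi_2(C,a)$ for every object $a$. Write $\Phi_f=\Phi(f)$. **Inducing.** $C$ induces a $\pi_2$-opindexing $\Phi$ on $H^*C$ if for every vertical $f:a\to b$ and every $\varphi\in\pi_2(C,b)$ one has $\varphi\circ U_f=U_f\circ\Phi_f(\varphi)$. $C$ induces a $\pi_2$-indexing $\Phi$ on $H^*C$ if for every vertical $f:a\to b$ and every $\varphi\in\pi_2(C,a)$ one has $U_f\circ\varphi=\Phi_f(\varphi)\circ U_f$. *)

(* Defs.v *)
From Stdlib Require Import FunctionalExtensionality ProofIrrelevance Eqdep.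

Set Implicit Arguments.
Unset Strict Implicit.
Unset Printing Implicit Defensive.

Declare Scope cat_scope.
Delimit Scope cat_scope with cat.
Local Open Scope cat_scope.

Record Category := {
  ob :> Type;
  hom : ob -> ob -> Type;
  idm : forall a, hom a a;
  comp : forall a b c, hom b c -> hom a b -> hom a c;
  comp_idl : forall a b (f : hom a b), comp (idm b) f = f;
  comp_idr : forall a b (f : hom a b), comp f (idm a) = f;
  comp_assoc : forall a b c d (h : hom c d) (g : hom b c) (f : hom a b),
    comp h (comp g f) = comp (comp h g) f }.

Arguments hom {_} _ _.
Arguments idm {_} _.
Arguments comp {_ _ _ _} _ _.
Notation "g ∘ f" := (comp g f) (at level 40, left associativity) : cat_scope.

(* The functors whose action on objects is the given function [F0]. *)
Record FunctorOn (C D : Category) (F0 : C -> D) := {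
  fmapOn : forall a b, hom a b -> hom (F0 a) (F0 b);
  fmapOn_id : forall a, fmapOn (idm a) = idm (F0 a);
  fmapOn_comp : forall a b c (g : hom b c) (f : hom a b),
    fmapOn (g ∘ f) = fmapOn g ∘ fmapOn f }.

Record Functor (C D : Category) := {
  fob :> C -> D;
  fstr : FunctorOn fob }.

Definition fmap (C D : Category) (F : Functor C D) (a b : C) (f : hom a b) :
  hom (F a) (F b) := fmapOn (fstr F) f.

Definition op_cat (C : Category) : Category := {|
  ob := C;
  hom := fun a b => @hom C b a;
  idm := fun a => idm a;
  comp := fun a b c g f => f ∘ g;
  comp_idl := fun a b f => comp_idr f;
  comp_idr := fun a b f => comp_idl f;
  comp_assoc := fun a b c d h g f => eq_sym (comp_assoc f g h) |}.

Definition prod_cat (C D : Category) : Category.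
Proof.
  refine {|
    ob := (C * D)%type;
    hom := fun x y => (hom (fst x) (fst y) * hom (snd x) (snd y))%type;
    idm := fun x => (idm (fst x), idm (snd x));
    comp := fun x y z g f => (fst g ∘ fst f, snd g ∘ snd f) |}.
  - intros a b [f g]; cbn; now rewrite !comp_idl.
  - intros a b [f g]; cbn; now rewrite !comp_idr.
  - intros a b c d [h h'] [g g'] [f f']; cbn; now rewrite !comp_assoc.
Defined.

Definition pair_functor (E C D : Category) (F : Functor E C) (G : Functor E D) :
  Functor E (prod_cat C D).
Proof.
  refine {|
    fob := fun x => (F x, G x) : prod_cat C D;
    fstr := @Build_FunctorOn E (prod_cat C D) (fun x => (F x, G x))
      (fun x y u => (fmap F u, fmap G u)) _ _ |}.
  - intros x; unfold fmap; now rewrite !fmapOn_id.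
  - intros x y z v u; unfold fmap; now rewrite !fmapOn_comp.
Defined.

Section Fibrations.

Variables (E B : Category) (P : Functor E B).

Definition cartesian (x y : E) (u : hom x y) : Prop :=
  forall (z : E) (v : hom z y) (h : hom (P z) (P x)),
    fmap P v = fmap P u ∘ h ->
    exists! w : hom z x, fmap P w = h /\ u ∘ w = v.

Definition opcartesian (x y : E) (u : hom x y) : Prop :=
  forall (z : E) (v : hom x z) (h : hom (P y) (P z)),
    fmap P v = h ∘ fmap P u ->
    exists! w : hom y z, fmap P w = h /\ w ∘ u = v.

(* [P x] is only propositionally equal to the prescribed object, so "u lies
   over f" is an equality of (object, arrow) pairs. *)
Definition lies_over_to (x y : E) (u : hom x y) (b : B) (f : hom b (P y)) :=
  existT (fun b' => hom b' (P y)) (P x) (fmap P u)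
  = existT (fun b' => hom b' (P y)) b f.

Definition lies_over_from (x y : E) (u : hom x y) (b : B) (f : hom (P x) b) :=
  existT (fun b' => hom (P x) b') (P y) (fmap P u)
  = existT (fun b' => hom (P x) b') b f.

Record Cleavage := {
  lift_ob : forall (y : E) (b : B), hom b (P y) -> E;
  lift : forall (y : E) (b : B) (f : hom b (P y)), hom (lift_ob f) y;
  lift_over : forall (y : E) (b : B) (f : hom b (P y)),
    lies_over_to (lift f) f;
  lift_cartesian : forall (y : E) (b : B) (f : hom b (P y)),
    cartesian (lift f) }.

Definition normal (K : Cleavage) : Prop :=
  forall y : E,
    existT (fun x => hom x y) (lift_ob K (idm (P y))) (lift K (idm (P y)))
    = existT (fun x => hom x y) y (idm y).

Definition opfibration : Prop :=
  forall (x : E) (b : B) (f : hom (P x) b),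
    exists (y : E) (u : hom x y), lies_over_from u f /\ opcartesian u.

End Fibrations.

Record CommMonoid := {
  cm_car :> Type;
  cm_one : cm_car;
  cm_op : cm_car -> cm_car -> cm_car;
  cm_opA : forall x y z, cm_op x (cm_op y z) = cm_op (cm_op x y) z;
  cm_op1x : forall x, cm_op cm_one x = x;
  cm_opC : forall x y, cm_op x y = cm_op y x }.

Record MonoidHom (A B : CommMonoid) := {
  mh_fun :> A -> B;
  mh_one : mh_fun (cm_one A) = cm_one B;
  mh_op : forall x y, mh_fun (cm_op x y) = cm_op (mh_fun x) (mh_fun y) }.

Lemma MonoidHom_ext (A B : CommMonoid) (f g : MonoidHom A B) :
  (forall x, f x = g x) -> f = g.
Proof.
  destruct f as [f f1 f2], g as [g g1 g2]; cbn; intros H.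
  assert (e : f = g) by (now apply functional_extensionality).
  destruct e; f_equal; apply proof_irrelevance.
Qed.

Definition MonoidHom_id (A : CommMonoid) : MonoidHom A A :=
  {| mh_fun := fun x => x; mh_one := eq_refl; mh_op := fun x y => eq_refl |}.

Definition MonoidHom_comp (A B C : CommMonoid)
  (g : MonoidHom B C) (f : MonoidHom A B) : MonoidHom A C.
Proof.
  refine {| mh_fun := fun x => g (f x) |}.
  - now rewrite !mh_one.
  - intros x y; now rewrite !mh_op.
Defined.

Definition commMon : Category.
Proof.
  refine {|
    ob := CommMonoid;
    hom := MonoidHom;
    idm := MonoidHom_id;
    comp := MonoidHom_comp |};
  intros; now apply MonoidHom_ext.
Defined.

(* Horizontal composition is written in diagrammatic order, vertical
   composition in applicative order. *)
Record Bicategory (O : Type) := {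
  cell1 : O -> O -> Type;
  cell2 : forall a b, cell1 a b -> cell1 a b -> Type;
  id2 : forall a b (M : cell1 a b), cell2 M M;
  comp2 : forall a b (M N P : cell1 a b), cell2 N P -> cell2 M N -> cell2 M P;
  comp2_idl : forall a b (M N : cell1 a b) (p : cell2 M N),
    comp2 (id2 N) p = p;
  comp2_idr : forall a b (M N : cell1 a b) (p : cell2 M N),
    comp2 p (id2 M) = p;
  comp2_assoc : forall a b (M N P Q : cell1 a b)
    (r : cell2 P Q) (q : cell2 N P) (p : cell2 M N),
    comp2 r (comp2 q p) = comp2 (comp2 r q) p;
  id1 : forall a, cell1 a a;
  comp1 : forall a b c, cell1 a b -> cell1 b c -> cell1 a c;
  hcomp2 : forall a b c (M M' : cell1 a b) (N N' : cell1 b c),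
    cell2 M M' -> cell2 N N' -> cell2 (comp1 M N) (comp1 M' N');
  hcomp2_id : forall a b c (M : cell1 a b) (N : cell1 b c),
    hcomp2 (id2 M) (id2 N) = id2 (comp1 M N);
  hcomp2_comp : forall a b c (M M' M'' : cell1 a b) (N N' N'' : cell1 b c)
    (p : cell2 M M') (p' : cell2 M' M'') (q : cell2 N N') (q' : cell2 N' N''),
    hcomp2 (comp2 p' p) (comp2 q' q) = comp2 (hcomp2 p' q') (hcomp2 p q);
  bassoc : forall a b c d (M : cell1 a b) (N : cell1 b c) (P : cell1 c d),
    cell2 (comp1 (comp1 M N) P) (comp1 M (comp1 N P));
  bassoc_inv : forall a b c d (M : cell1 a b) (N : cell1 b c) (P : cell1 c d),
    cell2 (comp1 M (comp1 N P)) (comp1 (comp1 M N) P);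
  blunit : forall a b (M : cell1 a b), cell2 (comp1 (id1 a) M) M;
  blunit_inv : forall a b (M : cell1 a b), cell2 M (comp1 (id1 a) M);
  brunit : forall a b (M : cell1 a b), cell2 (comp1 M (id1 b)) M;
  brunit_inv : forall a b (M : cell1 a b), cell2 M (comp1 M (id1 b));
  bassocK : forall a b c d (M : cell1 a b) (N : cell1 b c) (P : cell1 c d),
    comp2 (bassoc_inv M N P) (bassoc M N P) = id2 _;
  bassocVK : forall a b c d (M : cell1 a b) (N : cell1 b c) (P : cell1 c d),
    comp2 (bassoc M N P) (bassoc_inv M N P) = id2 _;
  blunitK : forall a b (M : cell1 a b),
    comp2 (blunit_inv M) (blunit M) = id2 _;
  blunitVK : forall a b (M : cell1 a b),
    comp2 (blunit M) (blunit_inv M) = id2 _;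
  brunitK : forall a b (M : cell1 a b),
    comp2 (brunit_inv M) (brunit M) = id2 _;
  brunitVK : forall a b (M : cell1 a b),
    comp2 (brunit M) (brunit_inv M) = id2 _;
  bassoc_nat : forall a b c d (M M' : cell1 a b) (N N' : cell1 b c)
    (P P' : cell1 c d) (p : cell2 M M') (q : cell2 N N') (r : cell2 P P'),
    comp2 (bassoc M' N' P') (hcomp2 (hcomp2 p q) r)
    = comp2 (hcomp2 p (hcomp2 q r)) (bassoc M N P);
  blunit_nat : forall a b (M M' : cell1 a b) (p : cell2 M M'),
    comp2 (blunit M') (hcomp2 (id2 (id1 a)) p) = comp2 p (blunit M);
  brunit_nat : forall a b (M M' : cell1 a b) (p : cell2 M M'),
    comp2 (brunit M') (hcomp2 p (id2 (id1 b))) = comp2 p (brunit M);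
  bpentagon : forall a b c d e (M : cell1 a b) (N : cell1 b c)
    (P : cell1 c d) (Q : cell1 d e),
    comp2 (hcomp2 (id2 M) (bassoc N P Q))
      (comp2 (bassoc M (comp1 N P) Q) (hcomp2 (bassoc M N P) (id2 Q)))
    = comp2 (bassoc M N (comp1 P Q)) (bassoc (comp1 M N) P Q);
  btriangle : forall a b c (M : cell1 a b) (N : cell1 b c),
    comp2 (hcomp2 (id2 M) (blunit N)) (bassoc M (id1 b) N)
    = hcomp2 (brunit M) (id2 N) }.

Section Pi2.

Variables (O : Type) (B : Bicategory O) (a : O).

Let I := id1 B a.
Let End := cell2 I I.

Lemma pi2_lwhisker (q : End) :
  hcomp2 (id2 I) q = comp2 (blunit_inv I) (comp2 q (blunit I)).
Proof.
  rewrite <- blunit_nat, comp2_assoc, blunitK; symmetry; apply comp2_idl.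
Qed.

Lemma pi2_rwhisker (p : End) :
  hcomp2 p (id2 I) = comp2 (brunit_inv I) (comp2 p (brunit I)).
Proof.
  rewrite <- brunit_nat, comp2_assoc, brunitK; symmetry; apply comp2_idl.
Qed.

Lemma pi2_whiskerC (p q : End) :
  comp2 (hcomp2 p (id2 I)) (hcomp2 (id2 I) q)
  = comp2 (hcomp2 (id2 I) q) (hcomp2 p (id2 I)).
Proof.
  now rewrite <- !hcomp2_comp, !comp2_idl, !comp2_idr.
Qed.

(* Eckmann-Hilton: the conjugate of [p] by the automorphism
   [blunit I . brunit_inv I] commutes with every [q], and conjugation is onto. *)
Lemma pi2_comm (p q : End) : comp2 p q = comp2 q p.
Proof.
  set (t := comp2 (blunit I) (brunit_inv I)).
  set (s := comp2 (brunit I) (blunit_inv I)).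
  assert (st : comp2 s t = id2 I).
  { unfold s, t.
    rewrite comp2_assoc, <- (comp2_assoc (brunit I) (blunit_inv I)).
    rewrite blunitK, comp2_idr; apply brunitVK. }
  assert (ts : comp2 t s = id2 I).
  { unfold s, t.
    rewrite comp2_assoc, <- (comp2_assoc (blunit I) (brunit_inv I)).
    rewrite brunitK, comp2_idr; apply blunitVK. }
  assert (H : forall x y : End,
    comp2 (comp2 t (comp2 x s)) y = comp2 y (comp2 t (comp2 x s))).
  { intros x y.
    assert (E : comp2 t (comp2 x s)
      = comp2 (blunit I) (comp2 (hcomp2 x (id2 I)) (blunit_inv I))).
    { rewrite pi2_rwhisker; unfold t, s; now rewrite !comp2_assoc. }
    assert (F : y = comp2 (blunit I) (comp2 (hcomp2 (id2 I) y) (blunit_inv I))).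
    { rewrite pi2_lwhisker, !comp2_assoc, blunitVK, comp2_idl.
      now rewrite <- comp2_assoc, blunitVK, comp2_idr. }
    assert (G : forall u v : cell2 (comp1 I I) (comp1 I I),
      comp2 (comp2 (blunit I) (comp2 u (blunit_inv I)))
            (comp2 (blunit I) (comp2 v (blunit_inv I)))
      = comp2 (blunit I) (comp2 (comp2 u v) (blunit_inv I))).
    { intros u v; rewrite !comp2_assoc.
      rewrite <- (comp2_assoc _ (blunit_inv I) (blunit I)), blunitK.
      now rewrite comp2_idr. }
    rewrite F, E, !G; now rewrite pi2_whiskerC. }
  specialize (H (comp2 s (comp2 p t)) q).
  assert (K : comp2 t (comp2 (comp2 s (comp2 p t)) s) = p).
  { rewrite <- !comp2_assoc, ts, comp2_idr, comp2_assoc, ts.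
    apply comp2_idl. }
  now rewrite K in H.
Qed.

Definition pi2 : CommMonoid := {|
  cm_car := End;
  cm_one := id2 I;
  cm_op := fun p q => comp2 p q;
  cm_opA := fun p q r => comp2_assoc p q r;
  cm_op1x := fun p => comp2_idl p;
  cm_opC := pi2_comm |}.

End Pi2.

Record DecoratedBicategory := {
  deco_cat : Category;
  deco_bicat : Bicategory (ob deco_cat) }.

Definition pi2_indexing (D : DecoratedBicategory) :=
  @FunctorOn (deco_cat D) commMon (fun a => pi2 (deco_bicat D) a).

Definition pi2_opindexing (D : DecoratedBicategory) :=
  @FunctorOn (op_cat (deco_cat D)) commMon (fun a => pi2 (deco_bicat D) a).

(* [sq f g M N] is the type of squares with left frame [f], right frame [g],
   top [M] and bottom [N]. *)
Record VerticalData (C0 : Category) := {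
  hor : C0 -> C0 -> Type;
  sq : forall a b a' b',
    hom a a' -> hom b b' -> hor a b -> hor a' b' -> Type;
  vid : forall a b (M : hor a b), sq (idm a) (idm b) M M;
  vcomp : forall a b a' b' a'' b''
    (f : hom a a') (f' : hom a' a'') (g : hom b b') (g' : hom b' b'')
    (M : hor a b) (N : hor a' b') (P : hor a'' b''),
    sq f' g' N P -> sq f g M N -> sq (f' ∘ f) (g' ∘ g) M P }.

(* A square with its frames not prescribed by its type. The strict laws of
   vertical composition are equations between such squares, since the frames
   of the two sides agree only propositionally. *)
Record Square (C0 : Category) (V : VerticalData C0) (a b a' b' : C0)
    (M : hor V a b) (N : hor V a' b') := mkSquare {
  left_frame : hom a a';
  right_frame : hom b b';
  cell : sq left_frame right_frame M N }.

Arguments mkSquare {C0 V a b a' b' M N left_frame right_frame} cell.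

Record DoubleCategory := {
  vcat : Category;
  vdata : VerticalData vcat;
  vcomp_idl : forall a b a' b' (f : hom a a') (g : hom b b')
    (M : hor vdata a b) (N : hor vdata a' b') (p : sq f g M N),
    mkSquare (vcomp (vid N) p) = mkSquare p;
  vcomp_idr : forall a b a' b' (f : hom a a') (g : hom b b')
    (M : hor vdata a b) (N : hor vdata a' b') (p : sq f g M N),
    mkSquare (vcomp p (vid M)) = mkSquare p;
  vcomp_assoc : forall a b a' b' a'' b'' a3 b3
    (f : hom a a') (f' : hom a' a'') (f'' : hom a'' a3)
    (g : hom b b') (g' : hom b' b'') (g'' : hom b'' b3)
    (M : hor vdata a b) (N : hor vdata a' b')
    (P : hor vdata a'' b'') (Q : hor vdata a3 b3)
    (r : sq f'' g'' P Q) (q : sq f' g' N P) (p : sq f g M N),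
    mkSquare (vcomp r (vcomp q p)) = mkSquare (vcomp (vcomp r q) p);
  hunit : forall a, hor vdata a a;
  usq : forall a b (f : hom a b), sq f f (hunit a) (hunit b);
  usq_id : forall a, usq (idm a) = vid (hunit a);
  usq_comp : forall a b c (g : hom b c) (f : hom a b),
    usq (g ∘ f) = vcomp (usq g) (usq f);
  (* horizontal composition is written in diagrammatic order *)
  hcomp : forall a b c, hor vdata a b -> hor vdata b c -> hor vdata a c;
  hsq : forall a b c a' b' c' (f : hom a a') (g : hom b b') (h : hom c c')
    (M : hor vdata a b) (N : hor vdata b c)
    (M' : hor vdata a' b') (N' : hor vdata b' c'),
    sq f g M M' -> sq g h N N' -> sq f h (hcomp M N) (hcomp M' N');
  hsq_id : forall a b c (M : hor vdata a b) (N : hor vdata b c),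
    hsq (vid M) (vid N) = vid (hcomp M N);
  hsq_comp : forall a b c a' b' c' a'' b'' c''
    (f : hom a a') (g : hom b b') (h : hom c c')
    (f' : hom a' a'') (g' : hom b' b'') (h' : hom c' c'')
    (M : hor vdata a b) (N : hor vdata b c)
    (M' : hor vdata a' b') (N' : hor vdata b' c')
    (M'' : hor vdata a'' b'') (N'' : hor vdata b'' c'')
    (p : sq f g M M') (p' : sq f' g' M' M'')
    (q : sq g h N N') (q' : sq g' h' N' N''),
    hsq (vcomp p' p) (vcomp q' q) = vcomp (hsq p' q') (hsq p q);
  dassoc : forall a b c d
    (M : hor vdata a b) (N : hor vdata b c) (P : hor vdata c d),
    sq (idm a) (idm d) (hcomp (hcomp M N) P) (hcomp M (hcomp N P));
  dassoc_inv : forall a b c d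
    (M : hor vdata a b) (N : hor vdata b c) (P : hor vdata c d),
    sq (idm a) (idm d) (hcomp M (hcomp N P)) (hcomp (hcomp M N) P);
  dlunit : forall a b (M : hor vdata a b),
    sq (idm a) (idm b) (hcomp (hunit a) M) M;
  dlunit_inv : forall a b (M : hor vdata a b),
    sq (idm a) (idm b) M (hcomp (hunit a) M);
  drunit : forall a b (M : hor vdata a b),
    sq (idm a) (idm b) (hcomp M (hunit b)) M;
  drunit_inv : forall a b (M : hor vdata a b),
    sq (idm a) (idm b) M (hcomp M (hunit b));
  dassocK : forall a b c d
    (M : hor vdata a b) (N : hor vdata b c) (P : hor vdata c d),
    mkSquare (vcomp (dassoc_inv M N P) (dassoc M N P)) = mkSquare (vid _);
  dassocVK : forall a b c d
    (M : hor vdata a b) (N : hor vdata b c) (P : hor vdata c d),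
    mkSquare (vcomp (dassoc M N P) (dassoc_inv M N P)) = mkSquare (vid _);
  dlunitK : forall a b (M : hor vdata a b),
    mkSquare (vcomp (dlunit_inv M) (dlunit M)) = mkSquare (vid _);
  dlunitVK : forall a b (M : hor vdata a b),
    mkSquare (vcomp (dlunit M) (dlunit_inv M)) = mkSquare (vid _);
  drunitK : forall a b (M : hor vdata a b),
    mkSquare (vcomp (drunit_inv M) (drunit M)) = mkSquare (vid _);
  drunitVK : forall a b (M : hor vdata a b),
    mkSquare (vcomp (drunit M) (drunit_inv M)) = mkSquare (vid _);
  dassoc_nat : forall a b c d a' b' c' d'
    (f : hom a a') (g : hom b b') (h : hom c c') (k : hom d d')
    (M : hor vdata a b) (N : hor vdata b c) (P : hor vdata c d)
    (M' : hor vdata a' b') (N' : hor vdata b' c') (P' : hor vdata c' d')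
    (p : sq f g M M') (q : sq g h N N') (r : sq h k P P'),
    mkSquare (vcomp (dassoc M' N' P') (hsq (hsq p q) r))
    = mkSquare (vcomp (hsq p (hsq q r)) (dassoc M N P));
  dlunit_nat : forall a b a' b' (f : hom a a') (g : hom b b')
    (M : hor vdata a b) (M' : hor vdata a' b') (p : sq f g M M'),
    mkSquare (vcomp (dlunit M') (hsq (usq f) p))
    = mkSquare (vcomp p (dlunit M));
  drunit_nat : forall a b a' b' (f : hom a a') (g : hom b b')
    (M : hor vdata a b) (M' : hor vdata a' b') (p : sq f g M M'),
    mkSquare (vcomp (drunit M') (hsq p (usq g)))
    = mkSquare (vcomp p (drunit M));
  dpentagon : forall a b c d e (M : hor vdata a b) (N : hor vdata b c)
    (P : hor vdata c d) (Q : hor vdata d e),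
    mkSquare (vcomp (hsq (vid M) (dassoc N P Q))
      (vcomp (dassoc M (hcomp N P) Q) (hsq (dassoc M N P) (vid Q))))
    = mkSquare (vcomp (dassoc M N (hcomp P Q)) (dassoc (hcomp M N) P Q));
  dtriangle : forall a b c (M : hor vdata a b) (N : hor vdata b c),
    mkSquare (vcomp (hsq (vid M) (dlunit N)) (dassoc M (hunit b) N))
    = mkSquare (hsq (drunit M) (vid N)) }.

Arguments hunit : clear implicits.

Record HMor (C : DoubleCategory) := mkHMor {
  hsrc : vcat C;
  htgt : vcat C;
  hmor : hor (vdata C) hsrc htgt }.

Arguments mkHMor {C hsrc htgt} hmor.

Definition C1 (C : DoubleCategory) : Category.
Proof.
  refine {|
    ob := HMor C;
    hom := fun X Y => Square (hmor X) (hmor Y);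
    idm := fun X => mkSquare (vid (hmor X));
    comp := fun X Y Z q p => mkSquare (vcomp (cell q) (cell p)) |}.
  - intros X Y [f g p]; apply vcomp_idl.
  - intros X Y [f g p]; apply vcomp_idr.
  - intros X Y Z W [f'' g'' r] [f' g' q] [f g p]; apply vcomp_assoc.
Defined.

Definition L (C : DoubleCategory) : Functor (C1 C) (vcat C) := {|
  fob := fun X : C1 C => hsrc X;
  fstr := {|
    fmapOn := fun (X Y : C1 C) (p : Square (hmor X) (hmor Y)) => left_frame p;
    fmapOn_id := fun X => eq_refl;
    fmapOn_comp := fun X Y Z q p => eq_refl |} |}.

Definition R (C : DoubleCategory) : Functor (C1 C) (vcat C) := {|
  fob := fun X : C1 C => htgt X;
  fstr := {|
    fmapOn := fun (X Y : C1 C) (p : Square (hmor X) (hmor Y)) => right_frame p;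
    fmapOn_id := fun X => eq_refl;
    fmapOn_comp := fun X Y Z q p => eq_refl |} |}.

Definition LxR (C : DoubleCategory) :
  Functor (C1 C) (prod_cat (vcat C) (vcat C)) := pair_functor (L C) (R C).

Definition U (C : DoubleCategory) : Functor (vcat C) (C1 C).
Proof.
  refine {|
    fob := fun a => mkHMor (hunit C a) : C1 C;
    fstr := @Build_FunctorOn (vcat C) (C1 C) (fun a => mkHMor (hunit C a))
      (fun a b f => mkSquare (usq f)) _ _ |}.
  - intros a; cbn; now rewrite usq_id.
  - intros a b c g f; cbn; now rewrite usq_comp.
Defined.

Section Globular.

Variable C : DoubleCategory.

Definition globular (a b : vcat C) (M N : hor (vdata C) a b) :=
  sq (idm a) (idm b) M N.

Definition globular_square (a b : vcat C) (M N : hor (vdata C) a b)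
  (p : globular M N) : @hom (C1 C) (mkHMor M) (mkHMor N) := mkSquare p.

Definition sq_cast (a b a' b' : vcat C) (f f' : hom a a') (g g' : hom b b')
    (M : hor (vdata C) a b) (N : hor (vdata C) a' b')
    (ef : f = f') (eg : g = g') (p : sq f g M N) : sq f' g' M N :=
  match ef in _ = x, eg in _ = y return sq x y M N with
  | eq_refl, eq_refl => p
  end.

(* The vertical composite has frames [idm a ∘ idm a] and [idm b ∘ idm b]. *)
Definition gcomp (a b : vcat C) (M N P : hor (vdata C) a b)
    (q : globular N P) (p : globular M N) : globular M P :=
  sq_cast (comp_idl (idm a)) (comp_idl (idm b)) (vcomp q p).

Lemma sq_castE (a b a' b' : vcat C) (f f' : hom a a') (g g' : hom b b')
    (M : hor (vdata C) a b) (N : hor (vdata C) a' b')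
    (ef : f = f') (eg : g = g') (p : sq f g M N) :
  mkSquare (sq_cast ef eg p) = mkSquare p.
Proof. now destruct ef, eg. Qed.

Lemma mkSquare_inj (a b a' b' : vcat C) (f : hom a a') (g : hom b b')
    (M : hor (vdata C) a b) (N : hor (vdata C) a' b') (p q : sq f g M N) :
  mkSquare p = mkSquare q -> p = q.
Proof.
  intros H.
  assert (K : existT (fun x => {y : hom b b' & sq x y M N}) f (existT _ g p)
    = existT _ f (existT _ g q)).
  { exact (f_equal (fun s => existT (fun x => {y : hom b b' & sq x y M N})
      (left_frame s) (existT _ (right_frame s) (cell s))) H). }
  apply inj_pair2 in K; now apply inj_pair2 in K.
Qed.

Lemma gcompE (a b : vcat C) (M N P : hor (vdata C) a b)
    (q : globular N P) (p : globular M N) :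
  mkSquare (gcomp q p) = mkSquare (vcomp q p).
Proof. apply sq_castE. Qed.

Lemma hsq_cast (a b c a' b' c' : vcat C)
    (f f' : hom a a') (g g' : hom b b') (h h' : hom c c')
    (M : hor (vdata C) a b) (N : hor (vdata C) b c)
    (M' : hor (vdata C) a' b') (N' : hor (vdata C) b' c')
    (ef : f = f') (eg : g = g') (eh : h = h')
    (p : sq f g M M') (q : sq g h N N') :
  mkSquare (hsq (sq_cast ef eg p) (sq_cast eg eh q)) = mkSquare (hsq p q).
Proof. now destruct ef, eg, eh. Qed.

Lemma vcomp_mkSquare (a b a' b' a'' b'' : vcat C)
    (M : hor (vdata C) a b) (N : hor (vdata C) a' b')
    (P : hor (vdata C) a'' b'')
    (f1 f2 : hom a a') (g1 g2 : hom b b')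
    (h1 h2 : hom a' a'') (k1 k2 : hom b' b'')
    (p1 : sq f1 g1 M N) (p2 : sq f2 g2 M N)
    (q1 : sq h1 k1 N P) (q2 : sq h2 k2 N P) :
  mkSquare q1 = mkSquare q2 -> mkSquare p1 = mkSquare p2 ->
  mkSquare (vcomp q1 p1) = mkSquare (vcomp q2 p2).
Proof.
  intros Hq Hp.
  exact (f_equal2 (fun s t : Square _ _ => mkSquare (vcomp (cell s) (cell t)))
    Hq Hp).
Qed.

Definition HC : Bicategory (ob (vcat C)).
Proof.
  refine {|
    cell1 := hor (vdata C);
    cell2 := globular;
    id2 := fun a b M => vid M;
    comp2 := gcomp;
    id1 := hunit C;
    comp1 := fun a b c M N => hcomp M N;
    hcomp2 := fun a b c M M' N N' p q => hsq p q;
    bassoc := fun a b c d M N P => dassoc M N P;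
    bassoc_inv := fun a b c d M N P => dassoc_inv M N P;
    blunit := fun a b M => dlunit M;
    blunit_inv := fun a b M => dlunit_inv M;
    brunit := fun a b M => drunit M;
    brunit_inv := fun a b M => drunit_inv M |};
  intros; try apply hsq_id; apply mkSquare_inj; rewrite ?gcompE.
  - apply vcomp_idl.
  - apply vcomp_idr.
  - rewrite (vcomp_mkSquare (q2 := r) (p2 := vcomp q p) eq_refl (gcompE q p)).
    rewrite (vcomp_mkSquare (q2 := vcomp r q) (p2 := p) (gcompE r q) eq_refl).
    apply vcomp_assoc.
  - unfold gcomp; rewrite hsq_cast; now rewrite hsq_comp.
  - apply dassocK.
  - apply dassocVK.
  - apply dlunitK.
  - apply dlunitVK.
  - apply drunitK.
  - apply drunitVK.
  - apply dassoc_nat.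
  - rewrite <- usq_id; apply dlunit_nat.
  - rewrite <- usq_id; apply drunit_nat.
  - etransitivity; [ | apply dpentagon ].
    apply vcomp_mkSquare; [ reflexivity | apply gcompE ].
  - apply dtriangle.
Defined.

Definition Hstar : DecoratedBicategory :=
  {| deco_cat := vcat C; deco_bicat := HC |}.

Definition pi2_square (a : vcat C) (p : pi2 HC a) :
  @hom (C1 C) (U C a) (U C a) := globular_square (M := hunit C a) p.

Definition induces_indexing (Phi : pi2_indexing Hstar) : Prop :=
  forall (a b : vcat C) (f : hom a b) (p : pi2 HC a),
    fmap (U C) f ∘ pi2_square p
    = pi2_square ((fmapOn Phi f : MonoidHom _ _) p) ∘ fmap (U C) f.

Definition induces_opindexing (Phi : pi2_opindexing Hstar) : Prop :=
  forall (a b : vcat C) (f : hom a b) (p : pi2 HC b),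
    pi2_square p ∘ fmap (U C) f
    = fmap (U C) f
      ∘ pi2_square ((@fmapOn _ _ _ Phi b a f : MonoidHom _ _) p).

End Globular.

Record FramedBicategory := {
  fb_double :> DoubleCategory;
  fb_cleavage : Cleavage (LxR fb_double);
  fb_normal : normal fb_cleavage;
  fb_opfibration : opfibration (LxR fb_double) }.

Definition fully_faithful (C : FramedBicategory) : Prop :=
  forall (a b : vcat C) (f : hom a b), cartesian (LxR C) (fmap (U C) f).

Definition absolutely_dense (C : FramedBicategory) : Prop :=
  forall (a b : vcat C) (f : hom a b), opcartesian (LxR C) (fmap (U C) f).

(* Main.v *)
From Stdlib Require Import ClassicalEpsilon.
Require Import Defs.

(** Say that endomorphisms [x] of [a] and [y] of [b] are intertwined by
    [u : a -> b] when [u ∘ x = y ∘ u]. Both statements ask to turn the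
    intertwining relation of the unit squares [U f] into a function, on the
    endomorphisms of the [U a] that are globular.

    If [U f] is cartesian over [(f, f)] and [y] is globular, then [y ∘ U f] also
    lies over [(f, f)], so it factors as [U f ∘ x] for exactly one [x] over the
    identity of [(a, a)], that is, for exactly one globular [x]
    ([cartesian_intertwines]). If [U f] is opcartesian, then dually [U f ∘ x]
    factors as [y ∘ U f] for exactly one globular [y]
    ([opcartesian_intertwines]).

    Functoriality costs nothing more: intertwined pairs are closed under
    identities and composition, both of the endomorphisms and of the
    intertwiners, so uniqueness forces the function to consist of monoid
    morphisms and to be functorial ([functorOn_of_relation]). *)

Set Implicit Arguments.
Unset Strict Implicit.
Unset Printing Implicit Defensive.

Local Open Scope cat_scope.

(** * Functors into commutative monoids from functional relations *)

(** The common core of the two halves, the contravariant one being the case of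
    an opposite category. Only unique existence of the images is known, so a
    description operator is needed to produce the functor. *)
Lemma functorOn_of_relation (V : Category) (M : V -> CommMonoid)
    (S : forall a b : V, hom a b -> M a -> M b -> Prop) :
  (forall a b (f : hom a b) x, exists! y, S a b f x y) ->
  (forall a b (f : hom a b), S a b f (cm_one (M a)) (cm_one (M b))) ->
  (forall a b (f : hom a b) x x' y y', S a b f x y -> S a b f x' y' ->
     S a b f (cm_op x x') (cm_op y y')) ->
  (forall a (x : M a), S a a (idm a) x x) ->
  (forall a b c (g : hom b c) (f : hom a b) x y z,
     S a b f x y -> S b c g y z -> S a c (g ∘ f) x z) ->
  exists Phi : @FunctorOn V commMon M,
    forall a b (f : hom a b) (x : M a),
      S a b f x ((fmapOn Phi f : MonoidHom _ _) x).
Proof.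
  intros Sex S1 Sop Sid Scomp.
  set (im := fun a b (f : hom a b) x =>
    proj1_sig (constructive_indefinite_description _ (Sex a b f x))).
  assert (imP : forall a b (f : hom a b) x, S a b f x (im a b f x)).
  { intros a b f x; unfold im.
    now destruct (constructive_indefinite_description _ (Sex a b f x))
      as [y [Hy y_uniq]]. }
  assert (imE : forall a b (f : hom a b) x y,
    S a b f x y -> im a b f x = y).
  { intros a b f x y Hy; destruct (Sex a b f x) as [z [Sz Hz]].
    rewrite <- (Hz y Hy); symmetry; apply Hz, imP. }
  set (phi := fun a b (f : hom a b) => {|
    mh_fun := im a b f;
    mh_one := imE _ _ _ _ _ (S1 a b f);
    mh_op := fun x x' => imE _ _ _ _ _
      (Sop a b f _ _ _ _ (imP a b f x) (imP a b f x')) |}).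
  unshelve eexists.
  - refine (@Build_FunctorOn V commMon M phi _ _).
    + intros a; apply MonoidHom_ext; intros x; apply imE, Sid.
    + intros a b c g f; apply MonoidHom_ext; intros x.
      apply imE; eapply Scomp; apply imP.
  - exact imP.
Qed.

(** * Intertwined endomorphisms *)

Definition intertwines (E : Category) (x y : E) (u : hom x y)
  (p : hom x x) (q : hom y y) : Prop := u ∘ p = q ∘ u.

Section Intertwining.

Variable E : Category.

Lemma intertwines_one (x y : E) (u : hom x y) :
  intertwines u (idm x) (idm y).
Proof. unfold intertwines; now rewrite comp_idl, comp_idr. Qed.

Lemma intertwines_id (x : E) (p : hom x x) : intertwines (idm x) p p.
Proof. unfold intertwines; now rewrite comp_idl, comp_idr. Qed.

Lemma intertwines_mul (x y : E) (u : hom x y) p p' q q' :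
  intertwines u p q -> intertwines u p' q' ->
  intertwines u (p ∘ p') (q ∘ q').
Proof.
  unfold intertwines; intros H H'.
  now rewrite comp_assoc, H, <- comp_assoc, H', comp_assoc.
Qed.

Lemma intertwines_comp (x y z : E) (v : hom y z) (u : hom x y) p q r :
  intertwines u p q -> intertwines v q r -> intertwines (v ∘ u) p r.
Proof.
  unfold intertwines; intros H H'.
  now rewrite <- comp_assoc, H, comp_assoc, H', comp_assoc.
Qed.

Variables (B : Category) (P : Functor E B).

(** The universal property, applied to [q ∘ u], which lies over the same arrow
    as [u] because [q] lies over an identity. *)
Lemma cartesian_intertwines (x y : E) (u : hom x y) (q : hom y y) :
  cartesian P u -> fmap P q = idm (P y) ->
  exists! p : hom x x, fmap P p = idm (P x) /\ intertwines u p q.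
Proof.
  intros Hu Hq; apply Hu.
  unfold fmap in *; now rewrite fmapOn_comp, Hq, comp_idl, comp_idr.
Qed.

Lemma opcartesian_intertwines (x y : E) (u : hom x y) (p : hom x x) :
  opcartesian P u -> fmap P p = idm (P x) ->
  exists! q : hom y y, fmap P q = idm (P y) /\ intertwines u p q.
Proof.
  intros Hu Hp.
  destruct (Hu y (u ∘ p) (idm (P y))) as [q [[Hq Hqu] q_uniq]].
  { unfold fmap in *; now rewrite fmapOn_comp, Hp, comp_idl, comp_idr. }
  exists q; split; [ now split | ].
  intros q' [Hq' Hq'u]; apply q_uniq; now split.
Qed.

End Intertwining.

(** * Globular endosquares of horizontal units *)

Section Pi2Squares.

Variables (C : DoubleCategory) (a : vcat C).

Lemma pi2_square_one : pi2_square (cm_one (pi2 (HC C) a)) = idm (U C a).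
Proof. reflexivity. Qed.

Lemma pi2_square_mul (p q : pi2 (HC C) a) :
  pi2_square (cm_op p q) = pi2_square p ∘ pi2_square q.
Proof. apply (gcompE (C := C)). Qed.

Lemma pi2_square_inj (p q : pi2 (HC C) a) :
  pi2_square p = pi2_square q -> p = q.
Proof. apply mkSquare_inj. Qed.

Lemma pi2_square_over_id (p : pi2 (HC C) a) :
  fmap (LxR C) (pi2_square p) = idm (LxR C (U C a)).
Proof. reflexivity. Qed.

Lemma pi2_square_of_over_id (w : hom (U C a) (U C a)) :
  fmap (LxR C) w = idm (LxR C (U C a)) ->
  exists p : pi2 (HC C) a, pi2_square p = w.
Proof.
  destruct w as [f g w]; intros H.
  injection H as Hf Hg; cbn in f, g, w, Hf, Hg; subst f g.
  now exists w.
Qed.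

(** The universal properties produce endomorphisms of [U a] over an identity;
    these are exactly the globular squares, with the same equality, so existence
    and uniqueness pass to the monoid. *)
Lemma pi2_unique_existence (Q : hom (U C a) (U C a) -> Prop) :
  (exists! w, fmap (LxR C) w = idm (LxR C (U C a)) /\ Q w) ->
  exists! p : pi2 (HC C) a, Q (pi2_square p).
Proof.
  intros [w [[Hw Qw] w_uniq]].
  destruct (pi2_square_of_over_id Hw) as [p Hp]; subst w.
  exists p; split; [ exact Qw | ].
  intros p' Qp'; apply pi2_square_inj, w_uniq; now split.
Qed.

End Pi2Squares.

(** * The relation between the monoids of globular squares *)

Section UnitIntertwining.

Variable C : DoubleCategory.

Definition unit_intertwines (a b : vcat C) (f : hom a b)
  (p : pi2 (HC C) a) (q : pi2 (HC C) b) : Prop :=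
  intertwines (fmap (U C) f) (pi2_square p) (pi2_square q).

Lemma unit_intertwines_one (a b : vcat C) (f : hom a b) :
  unit_intertwines f (cm_one _) (cm_one _).
Proof.
  unfold unit_intertwines; rewrite !pi2_square_one; apply intertwines_one.
Qed.

Lemma unit_intertwines_mul (a b : vcat C) (f : hom a b)
    (p p' : pi2 (HC C) a) (q q' : pi2 (HC C) b) :
  unit_intertwines f p q -> unit_intertwines f p' q' ->
  unit_intertwines f (cm_op p p') (cm_op q q').
Proof.
  unfold unit_intertwines; rewrite !pi2_square_mul; apply intertwines_mul.
Qed.

Lemma unit_intertwines_id (a : vcat C) (p : pi2 (HC C) a) :
  unit_intertwines (idm a) p p.
Proof.
  unfold unit_intertwines, fmap; rewrite fmapOn_id; apply intertwines_id.
Qed.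

Lemma unit_intertwines_comp (a b c : vcat C) (g : hom b c) (f : hom a b)
    (p : pi2 (HC C) a) (q : pi2 (HC C) b) (r : pi2 (HC C) c) :
  unit_intertwines f p q -> unit_intertwines g q r ->
  unit_intertwines (g ∘ f) p r.
Proof.
  unfold unit_intertwines, fmap; rewrite fmapOn_comp; apply intertwines_comp.
Qed.

End UnitIntertwining.

Theorem proposition5p1 :
  (forall C : FramedBicategory, fully_faithful C ->
     exists Phi : pi2_opindexing (Hstar C), induces_opindexing Phi) /\
  (forall C : FramedBicategory, absolutely_dense C ->
     exists Phi : pi2_indexing (Hstar C), induces_indexing Phi).
Proof.
  split; intros C Cunits.
  - destruct (@functorOn_of_relation (op_cat (vcat C)) (fun a => pi2 (HC C) a)
      (fun b a f q p => @unit_intertwines C a b f p q)) as [Phi HPhi].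
    + intros b a f q.
      apply (pi2_unique_existence
        (Q := fun w => intertwines (fmap (U C) f) w (pi2_square q))).
      apply cartesian_intertwines;
        [ apply Cunits | apply pi2_square_over_id ].
    + intros b a f; apply unit_intertwines_one.
    + intros b a f x x' y y'; apply unit_intertwines_mul.
    + intros a x; apply unit_intertwines_id.
    + intros c b a g f x y z Hf Hg; exact (unit_intertwines_comp Hg Hf).
    + exists Phi; intros a b f q; symmetry; exact (HPhi b a f q).
  - destruct (@functorOn_of_relation (vcat C) (fun a => pi2 (HC C) a)
      (@unit_intertwines C)) as [Phi HPhi].
    + intros a b f p.
      apply (pi2_unique_existence
        (Q := fun w => intertwines (fmap (U C) f) (pi2_square p) w)).
      apply opcartesian_intertwines;
        [ apply Cunits | apply pi2_square_over_id ].
    + apply unit_intertwines_one.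
    + apply unit_intertwines_mul.
    + apply unit_intertwines_id.
    + intros a b c g f x y z Hf Hg; exact (unit_intertwines_comp Hf Hg).
    + exists Phi; exact HPhi.
Qed.
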